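(* Let $n$ and $m$ be positive integers with $2\le m\le n$. Let $W=(w_{ij})$ be an $n\times n$ symmetric matrix whose entries $w_{ij}$, $i<j$, are independent random variables with $\mathbf{P}(w_{ij}=1)=\mathbf{P}(w_{ij}=-1)=1/2$, and define the random polynomial $$h_W(z)=\binom{n}{m}^{-1}\sum_{S\subset\{1,\dots,n\},\ |S|=m}\ \prod_{\{i,j\}\subset S}(1+z w_{ij}),$$ where the product is over unordered pairs of distinct elements of $S$. Let $r>0$ and $\tau>1$ be real numbers. If $$n\ \ge\ 2m^2(1+r^2)^m+2m,$$ then the probability that $h_W(z)$ has a root in the disc $|z|<r/\sqrt{2\tau}$ does not exceed $1/\tau$. *)

(* Defs.v *)
From HB Require Import structures.
From mathcomp Require Import all_boot all_order all_algebra.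
From mathcomp Require Import all_classical all_reals all_analysis.
From mathcomp Require Import complex.

Set Implicit Arguments.
Unset Strict Implicit.
Unset Printing Implicit Defensive.

Import Order.TTheory GRing.Theory Num.Theory.

Local Open Scope classical_set_scope.
Local Open Scope ring_scope.

(* Mutual independence of the subfamily (X i), i in D, of a finite family. *)
Definition mutually_independent (R : realType) (d : measure_display)
    (T : measurableType d) (P : probability T R)
    (I : finType) (D : pred I) (X : I -> {RV P >-> R}) : Prop :=
  forall (J : {set I}) (B : I -> set R),
    J \subset D -> (forall i, i \in J -> measurable (B i)) ->
    (P (\bigcap_(i in [set` J]) X i @^-1` B i)
       = \prod_(i in J) P (X i @^-1` B i))%E.

Definition random_matrix (R : realType) (d : measure_display)
    (T : measurableType d) (P : probability T R) (n : nat)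
    (w : 'I_n -> 'I_n -> {RV P >-> R}) (x : T) : 'M[R]_n :=
  \matrix_(i, j) w i j x.

(* For symmetric W the factor of an unordered pair {i, j} is the one indexed
   by its ordered representative i < j. *)
Definition clique_poly (F : fieldType) (n m : nat) (W : 'M[F]_n) : {poly F} :=
  'C(n, m)%:R^-1 *:
    \sum_(S : {set 'I_n} | #|S| == m)
      \prod_(i in S) \prod_(j in S | (i < j)%N) (1 + W i j *: 'X).

(* Main.v *)
Require Import Defs.
From HB Require Import structures.
From mathcomp Require Import all_boot all_order all_algebra.
From mathcomp Require Import complex.
From mathcomp Require Import ring lra.

(* If h(0) = 1 and h has a root a with |a| < r / sqrt (2 tau), then the mean Q of
   |h|^2 over the circle |z| = r, that is, the sum of |h_k|^2 r^(2k), is at least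
   r^2 / |a|^2 > 2 tau. This replaces Jensen's formula: dividing out the Blaschke
   factor of a does not change the l2 norm but multiplies the constant term by
   r / |a|. By Markov's inequality it remains to see that E Q <= 2. Orthogonality
   of the products of distinct w_ij turns E Q into the mean over two m-subsets
   S, S' of (1 + r^2)^C(|S cap S'|, 2) <= (1 + y)^|S cap S'|, where
   1 + y = (1 + r^2)^m. Expanding over A included in S cap S', and using that a
   given A lies in a random S' with probability at most (m / n)^|A|, bounds it by
   (1 + y m / n)^m <= (1 + 1 / (2 m))^m <= 2. *)

Set Implicit Arguments.
Unset Strict Implicit.
Unset Printing Implicit Defensive.

Import Order.TTheory GRing.Theory Num.Theory.

Local Open Scope ring_scope.

(** * Second moment of the coefficients *)

(* On the circle |z| = rho the factor z - a has the same modulus as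
   rho - a^* z / rho, so replacing one by the other preserves the l2 norm while
   the constant term becomes rho * g_0; at the level of partial sums the
   discrepancy telescopes. *)
Lemma root_l2_lower (C : numClosedFieldType) (h : {poly C}) (a rho : C) K :
  0 < rho -> root h a -> (size h <= K)%N ->
  rho ^+ 2 * `|h`_0| ^+ 2
    <= `|a| ^+ 2 * \sum_(k < K) `|h`_k| ^+ 2 * (rho ^+ 2) ^+ k.
Proof.
move=> rho_gt0 /factor_theorem[g ->] hK.
have [->|g0] := eqVneq g 0.
  rewrite mul0r coef0 normr0 expr0n mulr0 mulr_ge0 ?exprn_ge0 // sumr_ge0 // => k _.
  by rewrite mulr_ge0 ?exprn_ge0 // ltW.
have rhoR : rho^* = rho by apply/CrealP; rewrite gtr0_real.
have h0 : (g * ('X - a%:P))`_0 = - (g`_0 * a).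
  by rewrite mulrBr coefB coefMX coefMC sub0r.
have hS k : (g * ('X - a%:P))`_k.+1 = g`_k - g`_k.+1 * a.
  by rewrite mulrBr coefB coefMX coefMC.
have partial k : rho ^+ 2 * `|g`_0| ^+ 2
    - (rho ^+ 2 - `|a| ^+ 2) * (rho ^+ 2) ^+ k * `|g`_k| ^+ 2
    <= \sum_(l < k.+1) `|(g * ('X - a%:P))`_l| ^+ 2 * (rho ^+ 2) ^+ l.
  elim: k => [|k IHk].
    rewrite big_ord1 /= h0 normrN normrM expr0 le_eqVlt.
    by apply/orP; left; apply/eqP; ring.
  rewrite big_ord_recr /= hS.
  apply: le_trans (lerD IHk (lexx _)).
  rewrite -subr_ge0.
  have -> : forall x y z t : C, x + y - (z - t) = x + y + t - z by move=> *; ring.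
  set u := g`_k; set v := g`_k.+1; set w := g`_0.
  (* The right-hand side is the weighted square of the coefficient of index k + 1 of (rho - a^* z /
     rho) g, hence nonnegative. *)
  suff -> : rho ^+ 2 * `|w| ^+ 2
      - (rho ^+ 2 - `|a| ^+ 2) * (rho ^+ 2) ^+ k * `|u| ^+ 2
      + `|u - v * a| ^+ 2 * (rho ^+ 2) ^+ k.+1
      + (rho ^+ 2 - `|a| ^+ 2) * (rho ^+ 2) ^+ k.+1 * `|v| ^+ 2
      - rho ^+ 2 * `|w| ^+ 2
    = `|rho ^+ 2 * v - a^* * u| ^+ 2 * (rho ^+ 2) ^+ k.
    by rewrite mulr_ge0 ?exprn_ge0 ?normr_ge0 // ltW.
  rewrite !normCK !rmorphB /= rmorphM /= rmorphM /= rmorphXn /= rmorphM /= conjCK.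
  rewrite rhoR (exprS _ k).
  move: (_ ^+ k) => q; ring.
move: hK; rewrite size_Mmonic ?monicXsubC // size_XsubC addn2 /=.
case: K => // K; rewrite ltnS => gK.
(* After the case split K is one less than the size bound for h, so g_K = 0 and the correction term
   vanishes. *)
have := partial K; rewrite (nth_default 0 gK) normr0 expr0n /= mulr0 subr0 => le1.
rewrite h0 normrN normrM exprMn mulrA mulrC.
by rewrite ler_wpM2l // exprn_ge0.
Qed.

Lemma prod1D_subset (I : finType) (R : comNzRingType) (U : {set I}) (F : I -> R) :
  \prod_(i in U) (1 + F i) = \sum_(B : {set I} | B \subset U) \prod_(i in B) F i.
Proof.
rewrite big_mkcond /=.
(* Outside U the factor becomes 0 + 1, so that expanding over all subsets of I kills those not
   contained in U. *)
under eq_bigr => i _.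
  have -> : (if i \in U then 1 + F i else 1) = (if i \in U then F i else 0) + 1.
    by case: ifP => _; rewrite ?add0r // addrC.
  over.
rewrite bigA_distr [RHS]big_mkcond /=; apply: eq_bigr => B _.
rewrite -big_mkcond /=; case: ifP => [/subsetP BU|/negbT/subsetPn[i iB iU]].
  by apply: eq_bigr => i /BU ->.
by rewrite (bigD1 i) //= (negbTE iU) mul0r.
Qed.

(** * Walsh functions and their orthogonality *)

Section Walsh.
Variables (I : finType) (R : comNzRingType).
Implicit Types (U B s : {set I}) (q : R).

Lemma expr1D_subset U q :
  (1 + q) ^+ #|U| = \sum_(B : {set I} | B \subset U) q ^+ #|B|.
Proof.
rewrite -prodr_const prod1D_subset.
by apply: eq_bigr => B _; rewrite prodr_const.
Qed.

(** The set [s] encodes a sign vector by the positions of its entries -1; the value is -1 to the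
    power |s cap B|. *)
Definition walsh s B : R := \prod_(i in B) (-1) ^+ (i \in s).

Lemma walshC s B : walsh s B = walsh B s.
Proof.
rewrite /walsh !prodrXr; congr (_ ^+ _).
by rewrite big_mkcond [RHS]big_mkcond; apply: eq_bigr => i _; do 2!case: ifP.
Qed.

(** After [walshC] the sum over s is the expansion of a product over i in U, whose factor at i is 2
    if B and B' agree at i and 0 otherwise. *)
Lemma walsh_orthogonal U B B' : B \subset U -> B' \subset U ->
  \sum_(s : {set I} | s \subset U) walsh s B * walsh s B'
    = ((B == B')%:R * 2 ^+ #|U|).
Proof.
move=> BU B'U.
under eq_bigr => s _ do rewrite ![walsh s _]walshC -big_split /=.
rewrite -prod1D_subset; have [<-|neqB] := eqVneq B B'.
  rewrite mul1r -prodr_const; apply: eq_bigr => i _.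
  by rewrite -expr2 sqrr_sign.
suff [i iU iBB'] : exists2 i, i \in U & (i \in B) != (i \in B').
  rewrite (bigD1 i) //= -signr_addb; move: iBB'.
  by case: (i \in B); case: (i \in B') => //= _; rewrite addrN !mul0r.
apply/exists_inP; rewrite -negb_forall_in; apply: contra neqB => /forall_inP eqB.
apply/eqP/setP => i; have [/eqB|iU] := boolP (i \in U).
  by move=> /eqP.
by rewrite (contraNF (subsetP BU i) iU) (contraNF (subsetP B'U i) iU).
Qed.

Lemma coef_prod1DX U (F : I -> R) k :
  (\prod_(i in U) (1 + F i *: 'X))`_k
    = \sum_(B : {set I} | (B \subset U) && (#|B| == k)) \prod_(i in B) F i.
Proof.
rewrite (prod1D_subset U (fun i => F i *: 'X)) coef_sum [RHS]big_mkcondr /=.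
apply: eq_bigr => B _.
rewrite scaler_prod prodr_const coefZ coefXn eq_sym.
by case: eqP; rewrite ?mulr1 ?mulr0.
Qed.

(* Parseval for the Walsh functions [walsh _ B], which are orthogonal on the
   subsets of [U]. *)
Lemma sum_sqr_coef_sign (J : finType) (D : pred J) (f : J -> {set I}) U q :
  (forall j, D j -> f j \subset U) ->
  \sum_(s : {set I} | s \subset U) \sum_(k < #|I|.+1)
    ((\sum_(j | D j) \prod_(i in f j) (1 + (-1) ^+ (i \in s) *: 'X))`_k) ^+ 2
      * q ^+ k
  = 2 ^+ #|U| * \sum_(j | D j) \sum_(j' | D j') (1 + q) ^+ #|f j :&: f j'|.
Proof.
move=> fU.
pose P j k := [pred B : {set I} | (B \subset f j) && (#|B| == k)].
(* The square of the k-th coefficient is expanded into pairs of k-subsets B, B' of f j and f j';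
   summing over s leaves the diagonal B = B'. *)
transitivity (\sum_(k < #|I|.+1) \sum_(j | D j) \sum_(j' | D j')
    \sum_(B | P j k B) \sum_(B' | P j' k B')
    (B == B')%:R * 2 ^+ #|U| * q ^+ k).
  rewrite exchange_big /=; apply: eq_bigr => k _.
  under eq_bigr => s _.
    rewrite coef_sum expr2 big_distrl big_distrl /=.
    under eq_bigr => j _.
      rewrite big_distrr big_distrl /=.
      under eq_bigr => j' _.
        rewrite !coef_prod1DX big_distrl big_distrl /=.
        under eq_bigr => B _ do rewrite big_distrr big_distrl /=.
        over.
      over.
    over.
  rewrite exchange_big /=; apply: eq_bigr => j Dj.
  rewrite exchange_big /=; apply: eq_bigr => j' Dj'.
  rewrite exchange_big /=; apply: eq_bigr => B /andP[Bj _].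
  rewrite exchange_big /=; apply: eq_bigr => B' /andP[Bj' _].
  rewrite -big_distrl /= walsh_orthogonal //.
    exact: subset_trans Bj (fU _ Dj).
  exact: subset_trans Bj' (fU _ Dj').
rewrite big_distrr /= exchange_big; apply: eq_bigr => j Dj.
rewrite big_distrr /= exchange_big; apply: eq_bigr => j' Dj'.
rewrite expr1D_subset big_distrr /=.
(* The common subsets B are grouped by cardinality; [inord] is faithful since |B| is at most |I|. *)
rewrite [RHS](partition_big (fun B : {set I} => inord #|B| : 'I_#|I|.+1) xpredT) //=.
apply: eq_bigr => k _.
rewrite [LHS]big_mkcond [RHS]big_mkcond /=; apply: eq_bigr => B _.
have -> : (inord #|B| == k :> 'I_#|I|.+1) = (#|B| == k).
  by rewrite -val_eqE /= inordK // ltnS max_card.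
rewrite subsetI; case: (boolP (B \subset f j)) => //= Bj.
rewrite big_mkcond (bigD1 B) //= eqxx mul1r big1 ?addr0.
  by rewrite andbC; case: eqP => [->|] //=; rewrite andbF.
move=> B' B'B; rewrite [B == B']eq_sym (negbTE B'B) !mul0r; by case: ifP.
Qed.
End Walsh.

(** * Intersections of m-subsets *)

Lemma card_supersets (T : finType) (A : {set T}) m : (#|A| <= m)%N ->
  #|[set S : {set T} | (A \subset S) && (#|S| == m)]|
    = 'C(#|T| - #|A|, m - #|A|).
Proof.
move=> Am; have -> : (#|T| - #|A| = #|~: A|)%N by rewrite -(cardsC A) addKn.
rewrite -cards_draws -[RHS](@card_in_imset _ _ (fun B => A :|: B)).
  apply: eq_card => S; rewrite inE; apply/andP/imsetP => [[AS /eqP cS]|[B]].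
    exists (S :\: A); last first.
      by apply/setP => x; rewrite !inE; case: (boolP (x \in A)) => //= /(subsetP AS).
    by rewrite inE setDE subsetIr -setDE cardsDS // cS !eqxx.
  rewrite inE => /andP[BA /eqP cB] ->; rewrite subsetUl cardsU cB.
  by rewrite setIC disjoint_setI0 ?disjoints_subset // cards0 subn0 subnKC.
move=> B B'; rewrite !inE => /andP[BA _] /andP[B'A _] eqU.
have setDU (X : {set T}) : X \subset ~: A -> (A :|: X) :\: A = X.
  by move=> XA; rewrite setDUl setDv set0U; apply/setDidPl; rewrite disjoints_subset.
by rewrite -(setDU B) // eqU setDU.
Qed.

(** The ratio of the two binomials is the product of (m - l) / (n - l) over l < k, and each factor
    is at most m / n. *)
Lemma bin_sub_le n m k : (k <= m <= n)%N ->
  ('C(n - k, m - k) * n ^ k <= 'C(n, m) * m ^ k)%N.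
Proof.
elim: k => [|k IHk] /andP[km mn]; first by rewrite !subn0 !expn0.
have {}IHk := IHk (introT andP (conj (ltnW km) mn)).
have nk : (0 < n - k)%N by rewrite subn_gt0 (leq_trans km).
have diag := mul_bin_diag (n - k) (m - k.+1).
rewrite -subnS -subSn // subSS in diag.
suff le1 : ('C(n - k.+1, m - k.+1) * n <= 'C(n - k, m - k) * m)%N.
  rewrite !expnS mulnA (leq_trans (leq_mul le1 (leqnn _))) //.
  by rewrite mulnAC [leqRHS]mulnCA mulnC leq_mul2l IHk orbT.
rewrite -(leq_pmul2l nk) mulnA diag mulnAC [leqRHS]mulnCA mulnC leq_mul2l.
by apply/orP; right; rewrite !mulnBl [(m * n)%N]mulnC leq_sub2l // leq_mul2l mn orbT.
Qed.

Lemma sum_expr_cardI (R : realFieldType) (T : finType) (S : {set T}) m (y : R) :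
  #|S| = m -> (m <= #|T|)%N -> 0 <= y ->
  \sum_(S' : {set T} | #|S'| == m) (1 + y) ^+ #|S :&: S'|
    <= 'C(#|T|, m)%:R * (1 + y * m%:R / #|T|%:R) ^+ m.
Proof.
move=> cS mT y0; set n := #|T|.
under eq_bigr => S' _ do rewrite expr1D_subset.
rewrite (exchange_big_dep (fun A : {set T} => A \subset S)) /=; last first.
  by move=> S' A _; rewrite subsetI => /andP[].
rewrite -[X in _ ^+ X]cS expr1D_subset big_distrr /=; apply: ler_sum => A AS.
have Am : (#|A| <= m)%N by rewrite -cS subset_leq_card.
rewrite sumr_const -[_ *+ _]mulr_natl.
have -> : #|[pred S' : {set T} | (#|S'| == m) && (A \subset S :&: S')]|
    = 'C(n - #|A|, m - #|A|).
  rewrite -card_supersets //; apply: eq_card => S'.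
  by rewrite !inE subsetI AS andbC.
(* For n = 0 the quotient by n is a division by zero; but then m = 0, A is empty and all powers are
   1. *)
case: (posnP n) => [n0|n0].
  have m0 : m = 0%N by apply/eqP; rewrite -leqn0 -n0.
  by move: Am; rewrite n0 m0 leqn0 => /eqP ->; rewrite !expr0.
rewrite -mulrA exprMn [leRHS]mulrCA [leLHS]mulrC.
rewrite ler_wpM2l ?exprn_ge0 // expr_div_n mulrA ler_pdivlMr ?exprn_gt0 ?ltr0n //.
by rewrite -!natrX -!natrM ler_nat bin_sub_le // Am.
Qed.

(** A reverse Bernoulli inequality: while 2 k u <= 1, (1 + u) (1 + 2 k u) = 1 + 2 k u + u + (2 k u)
    u <= 1 + 2 (k + 1) u. *)
Lemma expr1D_le2 (R : realFieldType) (u : R) m :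
  0 <= u -> 2 * m%:R * u <= 1 -> (1 + u) ^+ m <= 2.
Proof.
move=> u0 mu.
have bern k : (k <= m)%N -> (1 + u) ^+ k <= 1 + 2 * k%:R * u.
  elim: k => [|k IHk] km; first by rewrite expr0 mulr0 mul0r addr0.
  have {}IHk := IHk (ltnW km).
  have ku : 2 * k%:R * u <= 1.
    apply: le_trans mu; rewrite ler_wpM2r // ler_wpM2l // ler_nat; exact: ltnW.
  rewrite exprS -[k.+1%:R]natr1; move: (k%:R) ((1 + u) ^+ k) IHk ku => x z zle xu.
  have := ler_wpM2l u0 xu; have := ler_wpM2l (addr_ge0 ler01 u0) zle; lra.
by apply: le_trans (bern m (leqnn m)) _; lra.
Qed.

(** * The clique polynomial of a sign matrix *)

Local Open Scope complex_scope.
Local Open Scope ring_scope.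

Definition upper_pairs n : {set 'I_n * 'I_n} :=
  [set p : 'I_n * 'I_n | (p.1 < p.2)%N].

Definition pairs_in n (S : {set 'I_n}) : {set 'I_n * 'I_n} :=
  [set p in upper_pairs n | (p.1 \in S) && (p.2 \in S)].

(** For [s] inside [upper_pairs n] the signs are prescribed above the diagonal, where [clique_poly]
    reads them; the other entries are 1. *)
Definition sign_matrix (R : pzRingType) n (s : {set 'I_n * 'I_n}) : 'M[R]_n :=
  \matrix_(i, j) (-1) ^+ ((i, j) \in s).

Lemma pairs_in_upper n (S : {set 'I_n}) : pairs_in S \subset upper_pairs n.
Proof. by apply/subsetP => p; rewrite inE => /andP[]. Qed.

(** The crude bound t^2 <= m t for t = |S cap S'| makes the exponent linear in t, as
    [sum_expr_cardI] requires. *)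
Lemma card_pairs_inI n (S S' : {set 'I_n}) m : #|S| = m ->
  (#|pairs_in S :&: pairs_in S'| <= m * #|S :&: S'|)%N.
Proof.
move=> cS; apply: (@leq_trans #|setX (S :&: S') (S :&: S')|).
  apply/subset_leq_card/subsetP => p; rewrite !inE.
  by move=> /andP[/andP[_ /andP[-> ->]] /andP[_ /andP[-> ->]]].
by rewrite cardsX leq_mul2r -cS subset_leq_card ?orbT // subsetIl.
Qed.

Lemma clique_polyE (F : fieldType) n m (W : 'M[F]_n) :
  clique_poly m W = 'C(n, m)%:R^-1 *:
    \sum_(S : {set 'I_n} | #|S| == m)
      \prod_(p in pairs_in S) (1 + W p.1 p.2 *: 'X).
Proof.
congr (_ *: _); apply: eq_bigr => S _; rewrite pair_big_dep /=.
by apply: eq_bigl => p; rewrite !inE andbA andbC.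
Qed.

Lemma map_clique_poly (F K : fieldType) (f : {rmorphism F -> K}) n m
    (W : 'M[F]_n) :
  clique_poly m (map_mx f W) = map_poly f (clique_poly m W).
Proof.
rewrite !clique_polyE linearZ /= fmorphV rmorph_nat rmorph_sum; congr (_ *: _).
apply: eq_bigr => S _; rewrite rmorph_prod; apply: eq_bigr => p _.
by rewrite mxE rmorphD rmorph1 /= linearZ /= map_polyX.
Qed.

Lemma clique_poly_coef0 (F : numFieldType) n m (W : 'M[F]_n) :
  (m <= n)%N -> (clique_poly m W)`_0 = 1.
Proof.
move=> mn; rewrite clique_polyE coefZ coef_sum.
rewrite (eq_bigr (fun=> 1)) => [|S _]; last first.
  rewrite -horner_coef0 horner_prod big1 // => p _.
  by rewrite !hornerE.
rewrite sumr_const -[in LHS]cardsE card_draws card_ord.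
by rewrite mulVf // pnatr_eq0 -lt0n bin_gt0.
Qed.

(** A bound by the number of all ordered pairs is enough, and it matches the range of k in
    [sum_sqr_coef_sign]. *)
Lemma size_clique_poly (F : fieldType) n m (W : 'M[F]_n) :
  (size (clique_poly m W) <= #|{: 'I_n * 'I_n}|.+1)%N.
Proof.
apply/leq_sizeP => k nk; rewrite clique_polyE coefZ coef_sum big1 ?mulr0 // => S _.
rewrite coef_prod1DX big_pred0 // => B; apply/negbTE.
rewrite negb_and orbC -implyNb negbK; apply/implyP => /eqP Bk.
by move: nk; rewrite -Bk ltnNge max_card.
Qed.

(* The mean of |p|^2 over the circle of radius [Num.sqrt q], provided
   [size p <= K]. *)
Definition sqr_l2norm (R : nzRingType) K (q : R) (p : {poly R}) : R :=
  \sum_(k < K) p`_k ^+ 2 * q ^+ k.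

(** This is E Q <= 2 with the expectation written as a sum over all sign choices above the
    diagonal. *)
Lemma sum_sqr_l2norm_clique_poly (R : realFieldType) n m (q : R) :
  (0 < m <= n)%N -> 0 <= q ->
  2 * m%:R ^+ 2 * (1 + q) ^+ m + 2 * m%:R <= n%:R ->
  \sum_(s : {set 'I_n * 'I_n} | s \subset upper_pairs n)
    sqr_l2norm #|{: 'I_n * 'I_n}|.+1 q (clique_poly m (sign_matrix R s))
  <= 2 * 2 ^+ #|upper_pairs n|.
Proof.
move=> /andP[m0 mn] q0 nm; set c : R := 'C(n, m)%:R.
have c0 : 0 < c by rewrite ltr0n bin_gt0.
have m0R : 0 < m%:R :> R by rewrite ltr0n.
have n0R : 0 < n%:R :> R by rewrite ltr0n (leq_trans m0).
pose y := (1 + q) ^+ m - 1.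
have y0 : 0 <= y by rewrite subr_ge0 exprn_ege1 // lerDl.
rewrite /sqr_l2norm.
under eq_bigr => s _.
  under eq_bigr => k _.
    rewrite clique_polyE coefZ exprMn -mulrA.
    under eq_bigr => S _ do under eq_bigr => p _ do rewrite mxE -surjective_pairing.
    over.
  rewrite -big_distrr /=; over.
rewrite -big_distrr /= sum_sqr_coef_sign; last by move=> S _; exact: pairs_in_upper.
have pairs_le (S : {set 'I_n}) : #|S| == m ->
    \sum_(S' : {set 'I_n} | #|S'| == m) (1 + q) ^+ #|pairs_in S :&: pairs_in S'|
    <= c * 2.
  move=> /eqP cS.
  apply: (@le_trans _ _ (\sum_(S' : {set 'I_n} | #|S'| == m) (1 + y) ^+ #|S :&: S'|)).
    apply: ler_sum => S' _; rewrite /y addrCA subrr addr0 -exprM.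
    by rewrite ler_weXn2l ?lerDl // card_pairs_inI.
  apply: le_trans (sum_expr_cardI cS _ y0) _; first by rewrite card_ord.
  rewrite card_ord ler_wpM2l ?(ltW c0) //.
  apply: expr1D_le2.
    by rewrite divr_ge0 ?mulr_ge0 // ltW.
  (* With u = y m / n the condition 2 m u <= 1 reads 2 m^2 y <= n. *)
  rewrite mulrA ler_pdivrMr // mul1r; apply: le_trans nm; rewrite /y.
  by have := sqr_ge0 (m%:R : R); nra.
have le2 : \sum_(S : {set 'I_n} | #|S| == m) \sum_(S' : {set 'I_n} | #|S'| == m)
    (1 + q) ^+ #|pairs_in S :&: pairs_in S'| <= c * (c * 2).
  apply: (@le_trans _ _ (\sum_(S : {set 'I_n} | #|S| == m) (c * 2))).
    exact: ler_sum.
  by rewrite sumr_const -[_ *+ #|_|]mulr_natl -[in leLHS]cardsE card_draws card_ord.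
rewrite mulrCA [leRHS]mulrC ler_wpM2l ?exprn_ge0 //.
rewrite exprVn -(ler_pM2l (exprn_gt0 2 c0)) mulrA divff ?mul1r ?gt_eqF ?exprn_gt0 //.
by rewrite expr2 -mulrA.
Qed.

(** By [root_l2_lower] with rho = r, r^2 <= |z|^2 Q <= (r^2 / tau) Q. *)
Lemma root_sqr_l2norm (R : rcfType) (h : {poly R}) K (r tau : R) (z : R[i]) :
  0 < r -> 0 < tau -> h`_0 = 1 -> (size h <= K)%N ->
  `|z| < (r / Num.sqrt tau)%:C -> root (map_poly (real_complex R) h) z ->
  tau <= sqr_l2norm K (r ^+ 2) h.
Proof.
move=> r0 tau0 h0 hK zr rz.
have rC : 0 < r%:C by rewrite -[0]/(0%:C) ltcR.
have := root_l2_lower rC rz; rewrite size_map_poly => /(_ K hK).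
have normR (x : R) : `|x%:C| ^+ 2 = (x ^+ 2)%:C.
  by rewrite -add_Re2_Im2 /= expr0n addr0.
rewrite coef_map h0 /= normr1 expr1n mulr1.
under eq_bigr => k _ do rewrite coef_map /= normR -!rmorphXn -rmorphM.
rewrite -rmorph_sum -/(sqr_l2norm K (r ^+ 2) h) -rmorphXn /= => le1.
set Q := sqr_l2norm _ _ _ in le1 *.
have Q0 : 0 <= Q.
  by apply: sumr_ge0 => k _; rewrite mulr_ge0 ?sqr_ge0 // exprn_ge0 ?sqr_ge0.
have : (r ^+ 2)%:C <= ((r / Num.sqrt tau) ^+ 2 * Q)%:C.
  apply: le_trans le1 _; rewrite rmorphM rmorphXn /= ler_wpM2r ?ler0c //.
  apply: lerXn2r (ltW zr); rewrite nnegrE ?normr_ge0 //.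
  exact: le_trans (normr_ge0 z) (ltW zr).
rewrite lecR expr_div_n sqr_sqrtr ?(ltW tau0) // -mulrA ler_pMr ?exprn_gt0 //.
by rewrite mulrC ler_pdivlMr // mul1r.
Qed.

(** * Measurability and probability *)

(* Imported only here because classical sets shadow lemmas and notations on
   finite sets used above. *)
From mathcomp Require Import all_classical all_reals all_analysis.
From mathcomp Require Import measurable_realfun.

Import Order.TTheory GRing.Theory Num.Theory.

Local Open Scope classical_set_scope.
Local Open Scope complex_scope.
Local Open Scope ring_scope.

(** Write h = (X - z) g with |g| <= M on the unit disc around z; then |h(q)| <= M |q - z|, and
    rational points are dense. *)
Lemma horner_near_root (R : realType) (h : {poly R[i]}) (z : R[i]) (eps del : R) :
  root h z -> 0 < eps -> 0 < del ->
  exists a b : rat, `|(ratr a +i* ratr b) - z| < del%:C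
    /\ `|h.[ratr a +i* ratr b]| < eps%:C.
Proof.
move=> /factor_theorem[g ->] eps0 del0.
pose M := complex.Re (1 + \sum_(k < size g) `|g`_k| * (`|z| + 1) ^+ k).
have ME : M%:C = 1 + \sum_(k < size g) `|g`_k| * (`|z| + 1) ^+ k.
  by rewrite RRe_real // ger0_real // addr_ge0 // sumr_ge0.
have M1 : 1 <= M.
  by rewrite -lecR ME lerDl sumr_ge0.
have M0 : 0 < M by apply: lt_le_trans M1.
(* Each coordinate is approximated within d, so |q - z| < 2 d; the bound 1 keeps q where M controls
   g. *)
pose d := Num.min (Num.min del 1) (eps / M) / 2.
have d0 : 0 < d by rewrite divr_gt0 // !lt_min del0 ltr01 divr_gt0.
have [a] := @rat_in_itvoo _ (complex.Re z - d) (complex.Re z + d) ltac:(lra).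
have [b] := @rat_in_itvoo _ (complex.Im z - d) (complex.Im z + d) ltac:(lra).
rewrite !in_itv /= => /andP[b1 b2] /andP[a1 a2]; exists a, b.
set q := _ +i* _.
have qz : `|q - z| < (2 * d)%:C.
  have -> : q - z = (ratr a - complex.Re z)%:C + 'i%C * (ratr b - complex.Im z)%:C.
    by rewrite [LHS]complexE; congr (_%:C + _ * _%:C); rewrite /q; case: (z).
  apply: le_lt_trans (ler_normD _ _) _; rewrite normrM !normc_def /=.
  rewrite !expr0n !expr1n /= add0r addr0 sqrtr1 mul1r addr0 !sqrtr_sqr.
  by rewrite -rmorphD /= ltcR mulr_natl mulr2n ltrD // ltr_norml; lra.
have d2 : 2 * d = Num.min (Num.min del 1) (eps / M).
  by rewrite /d mulrC divfK.
split; first by apply: lt_le_trans qz _; rewrite lecR d2 !ge_min lexx.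
rewrite hornerM hornerXsubC normrM.
have gM : `|g.[q]| <= M%:C.
  rewrite ME horner_coef; apply: le_trans (ler_norm_sum _ _ _) _.
  apply: le_trans (_ : _ <= \sum_(k < size g) `|g`_k| * (`|z| + 1) ^+ k) _; last first.
    by rewrite lerDr ler01.
  apply: ler_sum => k _; rewrite normrM normrX ler_wpM2l // lerXn2r ?nnegrE ?addr_ge0 //.
  rewrite -[q](subrK z) addrC; apply: le_trans (ler_normD _ _) _; rewrite lerD2l.
  apply: le_trans (ltW qz) _; by rewrite lecE /= eqxx d2 !ge_min lexx orbT.
have : `|q - z| < (eps / M)%:C.
  by apply: lt_le_trans qz _; rewrite lecR d2 !ge_min lexx !orbT.
have M0C : 0 < M%:C by rewrite -[0]/(0%:C) ltcR.
rewrite rmorphM fmorphV /= ltr_pdivlMr //; apply: le_lt_trans.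
by rewrite mulrC ler_wpM2l.
Qed.

(** Since h splits into linear factors, |h(q)| is at least |lead_coef h| times eps to the number of
    roots. *)
Lemma horner_away_roots (R : realType) (h : {poly R[i]}) (eps : R) :
  h != 0 -> 0 < eps ->
  exists2 c : R, 0 < c & forall q, (forall z, root h z -> eps%:C <= `|q - z|) ->
    c%:C <= `|h.[q]|.
Proof.
move=> h0 eps0; have [s hE] := closed_field_poly_normal h.
have lc0 : 0 < `|lead_coef h| by rewrite normr_gt0 lead_coef_eq0.
pose c := complex.Re `|lead_coef h|.
have cE : c%:C = `|lead_coef h| by rewrite RRe_real // ger0_real.
exists (c * eps ^+ size s).
  by rewrite mulr_gt0 ?exprn_gt0 // -ltcR cE.
move=> q qs; rewrite hE hornerZ normrM rmorphM /= cE ler_wpM2l //.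
rewrite rmorphXn /=.
have {hE h0 lc0 c cE}: forall z, z \in s -> eps%:C <= `|q - z|.
  by move=> z zs; apply: qs; rewrite hE rootZ ?lead_coef_eq0 // root_prod_XsubC.
elim: s {qs} => [|z s IHs] qs; first by rewrite big_nil hornerC normr1.
rewrite big_cons exprS hornerM normrM hornerXsubC ler_pM ?exprn_ge0 ?ler0c ?(ltW eps0) //.
  by rewrite qs ?mem_head.
by apply: IHs => y ys; apply: qs; rewrite inE ys orbT.
Qed.

(* The existential over the uncountable disc is replaced by one over rational
   points, which makes the event measurable even where the entries of the
   matrix are not +-1. *)
Lemma ex_root_disc (R : realType) (h : {poly R[i]}) (rho : R) : h != 0 ->
  (exists z, `|z| < rho%:C /\ root h z) <->
  exists k : nat, forall j : nat, exists a b : rat,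
    let q := ratr a +i* ratr b in
    `|q| + k.+1%:R^-1%:C < rho%:C /\ `|h.[q]| < j.+1%:R^-1%:C.
Proof.
move=> h0; split.
  move=> [z [zrho rz]].
  have [y zE] : exists y, y%:C = `|z|.
    by exists (complex.Re `|z|); rewrite RRe_real // ger0_real.
  rewrite -zE ltcR in zrho.
  have [k zk] := ltr_add_invr zrho.
  exists k => j.
  have del0 : 0 < rho - (y + k.+1%:R^-1) by rewrite subr_gt0.
  have j0 : 0 < j.+1%:R^-1 :> R by rewrite invr_gt0.
  have [a [b [near_z small]]] := horner_near_root rz j0 del0.
  exists a, b; split=> //; set q := _ +i* _ in near_z *.
  rewrite -ltrBrDr -rmorphB /= -[q](subrK z).
  apply: le_lt_trans (ler_normD _ _) _.
  by rewrite -ltrBrDr -zE -rmorphB /= (lt_le_trans near_z) // lecR opprD addrA addrAC lexx.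
move=> [k hk].
have k0 : 0 < k.+1%:R^-1 :> R by rewrite invr_gt0.
(* Without a root in the disc, every q with |q| + 1 / (k + 1) < rho is at distance at least 1 / (k +
   1) from all roots, so |h(q)| >= c; a large j contradicts this. *)
have [c c0 away] := horner_away_roots h0 k0.
have [j] := ltr_add_invr c0; rewrite add0r => jc.
have [a [b [qrho qj]]] := hk j; set q := _ +i* _ in qrho qj.
apply: contrapT => noroot.
have /away : forall z, root h z -> k.+1%:R^-1%:C <= `|q - z|.
  move=> z rz; rewrite real_leNgt ?normr_real ?ger0_real ?ler0c ?(ltW k0) //.
  apply/negP => qz; apply: noroot; exists z; split=> //.
  apply: le_lt_trans qrho; rewrite -[z](subrK q) addrC.
  by apply: le_trans (ler_normD _ _) _; rewrite lerD2l distrC ltW.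
by move=> /(le_lt_trans)/(_ qj); rewrite ltcR ltNge (ltW jc).
Qed.

(** * Measurability of complex-valued functions and of the root event *)

Definition cmeasurable_fun (R : realType) (d : measure_display)
    (T : measurableType d) (f : T -> R[i]) : Prop :=
  measurable_fun setT (fun x => complex.Re (f x)) /\
  measurable_fun setT (fun x => complex.Im (f x)).

Section ComplexMeasurability.
Variables (R : realType) (d : measure_display) (T : measurableType d).
Implicit Types f g : T -> R[i].

Lemma cmeasurable_cst (c : R[i]) : cmeasurable_fun (fun _ : T => c).
Proof. by split; exact: measurable_cst. Qed.

Lemma cmeasurable_real (f : T -> R) : measurable_fun setT f ->
  cmeasurable_fun (fun x => (f x)%:C).
Proof. by split=> //; exact: measurable_cst. Qed.

Lemma cmeasurableD f g : cmeasurable_fun f -> cmeasurable_fun g ->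
  cmeasurable_fun (fun x => f x + g x).
Proof.
move=> [f1 f2] [g1 g2]; split.
  apply: eq_measurable_fun (measurable_funD f1 g1) => x _ /=.
  by case: (f x) (g x) => [? ?] [? ?].
apply: eq_measurable_fun (measurable_funD f2 g2) => x _ /=.
by case: (f x) (g x) => [? ?] [? ?].
Qed.

Lemma cmeasurableM f g : cmeasurable_fun f -> cmeasurable_fun g ->
  cmeasurable_fun (fun x => f x * g x).
Proof.
move=> [f1 f2] [g1 g2]; split.
  apply: eq_measurable_fun
    (measurable_funB (measurable_funM f1 g1) (measurable_funM f2 g2)) => x _ /=.
  by case: (f x) (g x) => [? ?] [? ?].
apply: eq_measurable_fun
  (measurable_funD (measurable_funM f1 g2) (measurable_funM f2 g1)) => x _ /=.
by case: (f x) (g x) => [? ?] [? ?].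
Qed.

Lemma cmeasurable_sum (I : Type) (r : seq I) (P : pred I) (F : I -> T -> R[i]) :
  (forall i, cmeasurable_fun (F i)) ->
  cmeasurable_fun (fun x => \sum_(i <- r | P i) F i x).
Proof.
move=> mF; elim: r => [|i r IHr].
  under eq_fun do rewrite big_nil; exact: cmeasurable_cst.
under eq_fun do rewrite big_cons.
by case: (P i) => //; exact: cmeasurableD.
Qed.

Lemma cmeasurable_prod (I : Type) (r : seq I) (P : pred I) (F : I -> T -> R[i]) :
  (forall i, cmeasurable_fun (F i)) ->
  cmeasurable_fun (fun x => \prod_(i <- r | P i) F i x).
Proof.
move=> mF; elim: r => [|i r IHr].
  under eq_fun do rewrite big_nil; exact: cmeasurable_cst.
under eq_fun do rewrite big_cons.
by case: (P i) => //; exact: cmeasurableM.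
Qed.

Lemma cmeasurable_norm_lt f (eps : R) : 0 < eps -> cmeasurable_fun f ->
  measurable [set x | `|f x| < eps%:C].
Proof.
move=> eps0 [f1 f2].
have sqrt_lt a : (Num.sqrt a < eps) = (a < eps ^+ 2).
  by rewrite -{1}[eps]gtr0_norm // -sqrtr_sqr ltr_sqrt // exprn_gt0.
have -> : [set x | `|f x| < eps%:C] =
    setT `&` (fun x => complex.Re (f x) ^+ 2 + complex.Im (f x) ^+ 2)
      @^-1` `]-oo, eps ^+ 2[.
  by rewrite setTI; apply/seteqP; split=> x /=; rewrite in_itv /= normc_def ltcR sqrt_lt.
by apply: (measurable_funD (measurable_funX _ f1) (measurable_funX _ f2)).
Qed.

Lemma measurable_root_disc (h : T -> {poly R[i]}) (rho : R) :
  (forall x, h x != 0) -> (forall q, cmeasurable_fun (fun x => (h x).[q])) ->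
  measurable [set x | exists z : R[i], `|z| < rho%:C /\ root (h x) z].
Proof.
move=> h0 mh.
(* The condition on |q| does not involve x, so it becomes a case distinction and only |h(q)| has to
   be measurable. *)
have -> : [set x | exists z : R[i], `|z| < rho%:C /\ root (h x) z] =
    \bigcup_k \bigcap_j \bigcup_(a : rat) \bigcup_(b : rat)
      (if `|ratr a +i* ratr b : R[i]| + k.+1%:R^-1%:C < rho%:C then
         [set x | `|(h x).[ratr a +i* ratr b]| < j.+1%:R^-1%:C] else set0).
  apply/seteqP; split=> x /=.
    move=> /(ex_root_disc rho (h0 x))[k hk]; exists k => // j _.
    by have [a [b [qrho qj]]] := hk j; exists a => //; exists b => //; rewrite qrho.
  move=> [k _ hk]; apply/(ex_root_disc rho (h0 x)); exists k => j.
  have [a _ [b _]] := hk j I.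
  by case: ifP => // qrho qj; exists a, b.
apply: bigcupT_measurable => k; apply: bigcapT_measurable => j.
apply: bigcupT_measurable_rat => a; apply: bigcupT_measurable_rat => b.
case: ifP => _; last exact: measurable0.
by apply: cmeasurable_norm_lt; rewrite ?invr_gt0.
Qed.

End ComplexMeasurability.

Lemma cmeasurable_clique_poly (R : realType) (d : measure_display)
    (T : measurableType d) n m (W : T -> 'M[R]_n) (q : R[i]) :
  (forall i j, measurable_fun setT (fun x => W x i j)) ->
  cmeasurable_fun (fun x => (clique_poly m (map_mx (real_complex R) (W x))).[q]).
Proof.
move=> mW.
under eq_fun => x.
  rewrite hornerZ horner_sum.
  under eq_bigr => S _.
    rewrite horner_prod.
    under eq_bigr => i _.
      rewrite horner_prod.
      under eq_bigr => j _ do rewrite hornerD hornerC hornerZ hornerX mxE.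
      over.
    over.
  over.
apply: cmeasurableM; first exact: cmeasurable_cst.
apply: cmeasurable_sum => S; apply: cmeasurable_prod => i.
apply: cmeasurable_prod => j; apply: cmeasurableD; first exact: cmeasurable_cst.
by apply: cmeasurableM; [exact: cmeasurable_real | exact: cmeasurable_cst].
Qed.

(* The atoms on which [bad] fails are disjoint from the event [E]. *)
Lemma probability_le_card_atoms (R : realType) (d : measure_display)
    (T : measurableType d) (P : probability T R) (I : finType) (D bad : pred I)
    (A : I -> set T) (c : R) (E : set T) :
  (forall i, D i -> measurable (A i) /\ P (A i) = c%:E) ->
  (forall i j x, D i -> D j -> A i x -> A j x -> i = j) ->
  #|D|%:R * c = 1 -> measurable E ->
  (forall i x, D i -> A i x -> E x -> bad i) ->
  (P E <= (#|[pred i | D i && bad i]|%:R * c)%:E)%E.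
Proof.
move=> PA disjA cD mE badE.
pose r := enum [pred i | D i && ~~ bad i].
pose F := \bigcup_(i in [set` r]) A i.
have rD i : i \in r -> D i && ~~ bad i by rewrite mem_enum.
have mA i : [set` r] i -> measurable (A i).
  by move=> /rD/andP[Di _]; have [] := PA i Di.
have mF : measurable F by apply: fin_bigcup_measurable.
have PF : P F = (#|[pred i | D i && ~~ bad i]|%:R * c)%:E.
  rewrite measure_fin_bigcup //; last first.
    move=> i j /rD/andP[Di _] /rD/andP[Dj _] [x [Aix Ajx]].
    exact: disjA Aix Ajx.
  rewrite -fsbig_seq ?enum_uniq // (eq_big_seq (fun=> c%:E)) => [|i /rD/andP[Di _]].
    by rewrite sumEFin big_enum sumr_const mulr_natl.
  by have [] := PA i Di.
(* The atoms need not cover T, so E is bounded by the complement of the good atoms; as all atoms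
   have total mass 1, this complement has the mass of the bad ones. *)
apply: le_trans (_ : _ <= P (~` F))%E _.
  apply: le_measure; rewrite ?inE //; first exact: measurableC.
  move=> x Ex [i /rD/andP[Di nbad] Aix].
  by rewrite (badE i x Di Aix Ex) in nbad.
rewrite probability_setC // PF -EFinB lee_fin -[X in X - _]cD.
have -> : #|D| = (#|[pred i | D i && bad i]| + #|[pred i | D i && ~~ bad i]|)%N.
  by rewrite -(cardID bad D); congr addn; apply: eq_card => i; rewrite !inE // andbC.
by rewrite natrD mulrDl addrK.
Qed.

(** * The events that fix all signs above the diagonal *)

Section SignAtoms.
Variables (R : realType) (d : measure_display) (T : measurableType d).
Variables (P : probability T R) (n : nat) (w : 'I_n -> 'I_n -> {RV P >-> R}).

Definition sign_atom (s : {set 'I_n * 'I_n}) : set T :=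
  \bigcap_(p in [set` upper_pairs n])
    (w p.1 p.2 @^-1` [set (-1) ^+ (p \in s)]).

Lemma measurable_sign_atom s : measurable (sign_atom s).
Proof.
exact: fin_bigcap_measurable.
Qed.

Lemma probability_sign_atom s :
  mutually_independent (fun p : 'I_n * 'I_n => (p.1 < p.2)%N)
    (fun p => w p.1 p.2) ->
  (forall i j : 'I_n, (i < j)%N ->
     P [set x | w i j x = 1] = (2^-1)%:E /\
     P [set x | w i j x = -1] = (2^-1)%:E) ->
  P (sign_atom s) = (2^-1 ^+ #|upper_pairs n|)%:E.
Proof.
move=> indep half; rewrite /sign_atom (indep _ (fun p => [set (-1) ^+ (p \in s)])) //.
- rewrite (eq_bigr (fun=> (2^-1)%:E)); first by rewrite prodEFin prodr_const.
  move=> p; rewrite inE => /half[P1 PN1].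
  by case: (p \in s); rewrite ?expr0 ?expr1; [exact: PN1 | exact: P1].
- by apply/fintype.subsetP => p; rewrite inE.
Qed.

Lemma sign_atom_inj (s s' : {set 'I_n * 'I_n}) x :
  s \subset upper_pairs n -> s' \subset upper_pairs n ->
  sign_atom s x -> sign_atom s' x -> s = s'.
Proof.
move=> sU s'U sx s'x; apply/finset.setP => p.
have [pU|pU] := boolP (p \in upper_pairs n).
  by apply/(@signr_inj R); rewrite -(sx p pU) (s'x p pU).
by rewrite (contraNF (fintype.subsetP sU p) pU) (contraNF (fintype.subsetP s'U p) pU).
Qed.

Lemma clique_poly_sign_atom s x m : sign_atom s x ->
  clique_poly m (random_matrix w x) = clique_poly m (sign_matrix R s).
Proof.
move=> sx; rewrite !clique_polyE; congr (_ *: _); apply: eq_bigr => S _.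
apply: eq_bigr => p /(fintype.subsetP (pairs_in_upper S)) pU.
by rewrite !mxE -surjective_pairing (sx p pU).
Qed.

End SignAtoms.

(* Measurability of E is stated because P is total on sets and P E is the
   probability of E only when E is an event. *)
Theorem theorem1p4 (R : realType) (d : measure_display) (T : measurableType d)
    (P : probability T R) (n m : nat) (w : 'I_n -> 'I_n -> {RV P >-> R})
    (r tau : R) :
  (2 <= m <= n)%N ->
  (forall x : T, random_matrix w x \is symmetricmx) ->
  mutually_independent (fun p : 'I_n * 'I_n => (p.1 < p.2)%N)
    (fun p => w p.1 p.2) ->
  (forall i j : 'I_n, (i < j)%N ->
     P [set x | w i j x = 1] = (2^-1)%:E /\
     P [set x | w i j x = -1] = (2^-1)%:E) ->
  0 < r -> 1 < tau ->
  2 * m%:R ^+ 2 * (1 + r ^+ 2) ^+ m + 2 * m%:R <= n%:R :> R ->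
  let h (x : T) : {poly R[i]} :=
    clique_poly m (map_mx (real_complex R) (random_matrix w x)) in
  let E : set T :=
    [set x | exists z : R[i],
       `|z| < (r / Num.sqrt (2 * tau))%:C /\ root (h x) z] in
  measurable E /\ (P E <= (tau^-1)%:E)%E.
Proof.
move=> /andP[m2 mn] _ indep half r0 tau1 nm h E.
have hE x : h x = map_poly (real_complex R) (clique_poly m (random_matrix w x)).
  exact: map_clique_poly.
have mE : measurable E.
  apply: measurable_root_disc => [x|q].
    apply/eqP => /(congr1 (fun p : {poly R[i]} => p`_0))/eqP.
    by rewrite hE coef_map clique_poly_coef0 // coef0 oner_eq0.
  apply: cmeasurable_clique_poly => i j; under eq_fun do rewrite mxE.
  exact: measurable_funP.
split=> //.
set K := #|{: 'I_n * 'I_n}|.+1; set N := #|upper_pairs n|.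
pose D := [pred s : {set 'I_n * 'I_n} | s \subset upper_pairs n].
pose Q (s : {set 'I_n * 'I_n}) :=
  sqr_l2norm K (r ^+ 2) (clique_poly m (sign_matrix R s)).
pose bad := [pred s | 2 * tau <= Q s].
have tau0 : 0 < tau by apply: lt_trans tau1.
have cD : #|D| = (2 ^ N)%N.
  by rewrite -card_powerset; apply: eq_card => s; rewrite powersetE.
have Q0 s : 0 <= Q s.
  by apply: sumr_ge0 => k _; rewrite mulr_ge0 ?sqr_ge0 // exprn_ge0 ?sqr_ge0.
have := @probability_le_card_atoms _ _ _ P _ D bad (sign_atom w) (2^-1 ^+ N) E.
move=> /(_ _ _ _ mE _)/le_trans; apply.
- by move=> s _; split; [exact: measurable_sign_atom | exact: probability_sign_atom].
- exact: sign_atom_inj.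
- by rewrite cD natrX exprVn divff // expf_neq0.
- move=> s x _ sx [z [zr rz]]; rewrite /bad /=.
  apply: (root_sqr_l2norm r0 _ _ (size_clique_poly _ _) zr).
  + by rewrite mulr_gt0.
  + exact: clique_poly_coef0.
  + by rewrite -(clique_poly_sign_atom m sx) -hE.
rewrite lee_fin exprVn ler_pdivrMr ?exprn_gt0 // mulrC ler_pdivlMr //.
(* Markov's inequality by counting: each bad s contributes at least 2 tau to the sum of Q, which is
   at most 2 * 2^N. *)
rewrite -(ler_pM2l (ltr0n R 2)).
apply: le_trans (sum_sqr_l2norm_clique_poly _ (sqr_ge0 r) nm); last by rewrite (ltnW m2).
rewrite mulrCA mulr_natl -sumr_const.
rewrite big_mkcondr /= ler_sum // => s _; case: ifP => // _; exact: Q0.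
Qed.
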